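(* In the setting of the context, for any $\alpha>0$ we have $$\mathbf V^{(1)}_{\boldsymbol\theta}(\alpha)<_L\mathbf V^{(3)}_{\boldsymbol\theta}(\alpha)=\mathbf V^{(3)}_{\boldsymbol\theta}(0).$$
   Context: **Base chain.** $\mathcal N$ is a finite set with $N=|\mathcal N|$ elements, identified with $\{1,\dots,N\}$. $\Sigma$ is the probability simplex in $\mathbb R^N$, $\mathrm{Int}(\Sigma)$ its (relative) interior. $\mathbf P=[P_{ij}]$ is the transition matrix of an ergodic Markov chain on $\mathcal N$ with stationary distribution $\boldsymbol\mu\in\mathrm{Int}(\Sigma)$, time-reversible: $\mu_iP_{ij}=\mu_jP_{ji}$ for all $i,j$. Its eigenvalues are ordered $-1<\lambda_1\le\cdots\le\lambda_{N-1}<\lambda_N=1$, with left eigenvectors $\mathbf u_i$ and right eigenvectors $\mathbf v_i$, $\mathbf u_N=\boldsymbol\mu$, $\mathbf v_N=\mathbf 1$ (all-ones vector), normalized so that $\mathbf u_i^T\mathbf v_i=1$, $\mathbf u_i^T\mathbf v_j=0$ for $i\ne j$, and $\mathbf u_i=\mathrm{diag}(\boldsymbol\mu)\mathbf v_i$. **Algorithm.** $H:\mathbb R^D\times\mathcal N\to\mathbb R^D$ is given; $\mathbf h(\boldsymbol\theta)=\sum_{i\in\mathcal N}\mu_iH(\boldsymbol\theta,i)$, and $\nabla$ is the Jacobian in $\boldsymbol\theta$. For $\alpha\ge0$, the SA-SRRW algorithm is $$X_{n+1}\sim\mathbf K_{X_n,\cdot}[\mathbf x_n],\quad \mathbf x_{n+1}=\mathbf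 x_n+\gamma_{n+1}(\boldsymbol\delta_{X_{n+1}}-\mathbf x_n),\quad \boldsymbol\theta_{n+1}=\boldsymbol\theta_n+\beta_{n+1}H(\boldsymbol\theta_n,X_{n+1}),$$ with $K_{ij}[\mathbf x]=P_{ij}(x_j/\mu_j)^{-\alpha}/\sum_{k}P_{ik}(x_k/\mu_k)^{-\alpha}$ and $\boldsymbol\delta_j$ the $j$-th standard basis vector of $\mathbb R^N$. The stationary distribution of $\mathbf K[\mathbf x]$ is denoted $\boldsymbol\pi[\mathbf x]$. A matrix is Hurwitz if all its eigenvalues have strictly negative real parts. Put $\Theta=\{\boldsymbol\theta^*:\mathbf h(\boldsymbol\theta^* )=\mathbf 0,\ \nabla\mathbf h(\boldsymbol\theta^* )+\tfrac{\mathbf 1_{\{b=1\}}}{2}\mathbf I\text{ is Hurwitz}\}$, with $b$ the exponent of $\beta_n$ in (A2). **Assumptions.** (A1) $H$ is continuous at every $\boldsymbol\theta\in\mathbb R^D$, and there is $L>0$ with $\|H(\boldsymbol\theta,i)\|\le L(1+\|\boldsymbol\theta\|)$ for every $\boldsymbol\theta\in\mathbb R^D$, $i\in\mathcal N$. (A2) $\beta_n=(n+1)^{-b}$, $\gamma_n=(n+1)^{-a}$ with $a,b\in(0.5,1]$. Case (i) is $a<b$ and case (iii) is $a>b$. (A3) The roots of $\mathbf h$ are disjoint (isolated points) and comprise the set $\Theta\neq\emptyset$, which is the globally attracting set of the ODE $d\boldsymbol\theta(t)/dt=\mathbf h(\boldsymbol\theta(t))$. (A3') For any $\mathbf x\in\mathrm{Int}(\Sigma)$,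 there exists a function $\rho:\mathrm{Int}(\Sigma)\to\mathbb R^D$ such that $\|\rho(\mathbf x)\|\le L_2(1+\|\mathbf x\|)$ for some $L_2>0$, $\mathbb E_{i\sim\boldsymbol\pi[\mathbf x]}[H(\rho(\mathbf x),i)]=\mathbf 0$, and $\mathbb E_{i\sim\boldsymbol\pi[\mathbf x]}[\nabla H(\rho(\mathbf x),i)]+\tfrac{\mathbf 1_{\{b=1\}}}{2}\mathbf I$ is Hurwitz. (A4) For any initial point $(\boldsymbol\theta_0,\mathbf x_0,X_0)\in\mathbb R^D\times\mathrm{Int}(\Sigma)\times\mathcal N$, $\{\boldsymbol\theta_n\}$ (resp. $\{\mathbf x_n\}$) is almost surely contained within a compact subset of $\mathbb R^D$ (resp. $\mathrm{Int}(\Sigma)$). Assumptions (A1)–(A4) are in force, with (A3') replacing (A3) in case (iii). **The matrices.** Let $\boldsymbol\theta^*\in\Theta$, condition on the event $\{\boldsymbol\theta_n\to\boldsymbol\theta^*\}$, and let $\mathbf H=[H(\boldsymbol\theta^*,1),\dots,H(\boldsymbol\theta^*,N)]^T\in\mathbb R^{N\times D}$. For $\alpha\ge0$, the asymptotic covariance matrices of $\beta_n^{-1/2}(\boldsymbol\theta_n-\boldsymbol\theta^* )$ are, in case (i) (where $b=1$ is allowed), $$\mathbf V^{(1)}_{\boldsymbol\theta}(\alpha)=\int_0^\infty e^{t\left(\nabla\mathbf h(\boldsymbol\theta^* )+\frac{\mathbf 1_{\{b=1\}}}{2}\mathbf I\right)}\,\mathbf U_{\boldsymbol\theta}(\alpha)\,e^{t\left(\nabla\mathbf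 h(\boldsymbol\theta^* )+\frac{\mathbf 1_{\{b=1\}}}{2}\mathbf I\right)^T}dt,$$ and in case (iii) (where $b<a\le1$), $$\mathbf V^{(3)}_{\boldsymbol\theta}(\alpha)=\int_0^\infty e^{t\nabla\mathbf h(\boldsymbol\theta^* )}\,\mathbf U_{11}\,e^{t\nabla\mathbf h(\boldsymbol\theta^* )^T}dt,$$ where $$\mathbf U_{\boldsymbol\theta}(\alpha)=\sum_{i=1}^{N-1}\frac{1}{(\alpha(1+\lambda_i)+1)^2}\cdot\frac{1+\lambda_i}{1-\lambda_i}\,\mathbf H^T\mathbf u_i\mathbf u_i^T\mathbf H,\qquad \mathbf U_{11}=\sum_{i=1}^{N-1}\frac{1+\lambda_i}{1-\lambda_i}\,\mathbf H^T\mathbf u_i\mathbf u_i^T\mathbf H.$$ **Notation.** For symmetric matrices, $\mathbf M_1<_L\mathbf M_2$ means that $\mathbf M_2-\mathbf M_1$ is positive semi-definite and $\mathbf M_1\ne\mathbf M_2$.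
   Formalization: The claim is proved under the added condition that H(θ*,i) ≠ 0 for at least one state i; otherwise both covariance matrices are zero and the strict inequality fails (e.g. H(θ,i) = −θ, θ* = 0). Both matrices are taken for the same exponent b, hence b < 1. *)

(* Defs.v *)
From HB Require Import structures.
From mathcomp Require Import all_boot all_order all_algebra.
From mathcomp Require Import complex.
From mathcomp Require Import all_classical all_reals all_analysis.

Set Implicit Arguments.
Unset Strict Implicit.
Unset Printing Implicit Defensive.

Import Order.TTheory GRing.Theory Num.Theory.
Import numFieldNormedType.Exports.

Local Open Scope classical_set_scope.
Local Open Scope ring_scope.

(* Vectors are columns.  The N states are 'I_n.+1, so N = n.+1 >= 1 and the
   index N of the top eigenvalue is ord_max. *)

Section Matrices.
Context {R : realType}.

Definition psd m (M : 'M[R]_m) : Prop :=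
  M^T = M /\ forall x : 'cV[R]_m, 0 <= (x^T *m M *m x) 0 0.

(* The order is only meant for symmetric matrices; symmetry of both sides is
   part of the relation. *)
Definition loewner_lt m (M1 M2 : 'M[R]_m) : Prop :=
  [/\ M1^T = M1, M2^T = M2, psd (M2 - M1) & M1 <> M2].

Definition hurwitz m (A : 'M[R]_m) : Prop :=
  forall z : R[i],
    eigenvalue (map_mx (real_complex R) A) z -> complex.Re z < 0.

Definition expmx m (A : 'M[R]_m) : 'M[R]_m :=
  limn (series (fun k => (k`!%:R)^-1 *: A ^+ k)).

Definition integral0y_mx m (F : R -> 'M[R]_m) : 'M[R]_m :=
  \matrix_(i, j) \int[lebesgue_measure]_(t in `[0, +oo[) F t i j.

(* Entry (i, j) is the partial derivative of f_i in the j-th coordinate; this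
   is the transpose of the library's row-vector [jacobian]. *)
Definition nabla m p (f : 'cV[R]_m -> 'cV[R]_p) (x : 'cV[R]_m)
    : 'M[R]_(p, m) :=
  \matrix_(i, j) ('D_(delta_mx j 0) f x) i 0.

End Matrices.

Section BaseChain.
Context {R : realType} {n : nat}.
Implicit Types (P : 'M[R]_n.+1) (mu x : 'cV[R]_n.+1).

Definition simplex : set 'cV[R]_n.+1 :=
  [set x | (forall i, 0 <= x i 0) /\ \sum_i x i 0 = 1].

Definition int_simplex : set 'cV[R]_n.+1 :=
  [set x | (forall i, 0 < x i 0) /\ \sum_i x i 0 = 1].

Definition stochastic P : Prop :=
  (forall i j, 0 <= P i j) /\ forall i, \sum_j P i j = 1.

Definition irreducible P : Prop := forall i j, exists k, 0 < (P ^+ k) i j.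

Definition aperiodic P : Prop :=
  forall i d, (forall k, (0 < k)%N -> 0 < (P ^+ k) i i -> (d %| k)%N) ->
    d = 1%N.

Definition ergodic P : Prop :=
  [/\ stochastic P, irreducible P & aperiodic P].

Definition stationary P mu : Prop := simplex mu /\ mu^T *m P = mu^T.

Definition reversible P mu : Prop :=
  forall i j, mu i 0 * P i j = mu j 0 * P j i.

Record spectral_system P mu
    (lambda : 'I_n.+1 -> R) (u v : 'I_n.+1 -> 'cV[R]_n.+1) : Prop := {
  lambda_sorted : forall i j : 'I_n.+1, (i <= j)%N -> lambda i <= lambda j ;
  lambda_gtN1 : forall i, -1 < lambda i ;
  lambda_lt1 : forall i, i != ord_max -> lambda i < 1 ;
  lambda_max : lambda ord_max = 1 ;
  u_left : forall i, (u i)^T *m P = lambda i *: (u i)^T ;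
  v_right : forall i, P *m v i = lambda i *: v i ;
  u_max : u ord_max = mu ;
  v_max : v ord_max = const_mx 1 ;
  uv_biorth : forall i j, ((u i)^T *m v j) 0 0 = (i == j)%:R ;
  u_diag : forall i, u i = diag_mx mu^T *m v i }.

Definition srrw_kernel P mu (alpha : R) x : 'M[R]_n.+1 :=
  \matrix_(i, j)
    (P i j * (x j 0 / mu j 0) `^ (- alpha)
       / (\sum_k P i k * (x k 0 / mu k 0) `^ (- alpha))).

End BaseChain.

Section Algorithm.
Context {R : realType} {n D : nat}.
Implicit Types (P : 'M[R]_n.+1) (mu x : 'cV[R]_n.+1) (theta : 'cV[R]_D).
Implicit Types (H : 'cV[R]_D -> 'I_n.+1 -> 'cV[R]_D) (s : nat -> 'I_n.+1).
Implicit Types (alpha a b : R).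

Definition mean_field mu H theta : 'cV[R]_D := \sum_i mu i 0 *: H theta i.

(* The step sizes are beta_k = step b k and gamma_k = step a k. *)
Definition step (c : R) (k : nat) : R := k.+1%:R `^ (- c).

(* Both iterates are functions of the initial point and of the visited states
   s 0, s 1, ...; the state s 0 does not enter the updates. *)
Fixpoint x_iter a (x0 : 'cV[R]_n.+1) s k : 'cV[R]_n.+1 :=
  if k is k'.+1 then
    x_iter a x0 s k' + step a k *: (delta_mx (s k) 0 - x_iter a x0 s k')
  else x0.

Fixpoint theta_iter b H (theta0 : 'cV[R]_D) s k : 'cV[R]_D :=
  if k is k'.+1 then
    theta_iter b H theta0 s k' + step b k *: H (theta_iter b H theta0 s k') (s k)
  else theta0.

(* X is the state process of a run started at (x0, X0).  Since the iterates are
   functions of the path, the conditional law of X_{k+1} given the past is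
   prescribed by the probabilities of the finite path cylinders. *)
Definition srrw_process P mu alpha a x0 (X0 : 'I_n.+1)
    (d : measure_display) (T : measurableType d) (Pr : probability T R)
    (X : nat -> T -> 'I_n.+1) : Prop :=
  [/\ forall k i, measurable [set w | X k w = i],
      forall w, X 0%N w = X0 &
      forall s k,
        Pr [set w | forall l, (l <= k.+1)%N -> X l w = s l] =
        (Pr [set w | forall l, (l <= k)%N -> X l w = s l] *
         (srrw_kernel P mu alpha (x_iter a x0 s k) (s k) (s k.+1))%:E)%E].

Definition regular_growth H : Prop :=
  (forall i, continuous (H^~ i)) /\
  exists2 L : R, 0 < L & forall theta i, `|H theta i| <= L * (1 + `|theta|).

Definition step_exponents a b : Prop := 1 / 2 < a <= 1 /\ 1 / 2 < b <= 1.

Definition half_ind b : R := (b == 1)%:R / 2.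

Definition Theta mu H b : set 'cV[R]_D :=
  [set theta | [/\ mean_field mu H theta = 0,
     differentiable (mean_field mu H) theta &
     hurwitz (nabla (mean_field mu H) theta + (half_ind b)%:M)]].

Definition ode_solution (f : 'cV[R]_D -> 'cV[R]_D) (y : R -> 'cV[R]_D) : Prop :=
  {within `[0, +oo[, continuous y} /\
  forall t : R, 0 < t -> is_derive t 1 y (f (y t)).

Definition globally_attracting (f : 'cV[R]_D -> 'cV[R]_D)
    (A : set 'cV[R]_D) : Prop :=
  forall y, ode_solution f y -> forall e : R, 0 < e ->
    \forall t \near +oo, exists2 z, A z & `|y t - z| < e.

Definition root_assumption mu H b : Prop :=
  let roots := [set theta | mean_field mu H theta = 0] in
  [/\ forall theta, roots theta ->
        exists2 e : R, 0 < e & ball theta e `&` roots = [set theta],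
      roots = Theta mu H b, Theta mu H b !=set0 &
      globally_attracting (mean_field mu H) (Theta mu H b)].

(* For x in int_simplex the kernel at x is ergodic, so that "every stationary
   distribution pi" means "the stationary distribution pi[x]". *)
Definition root_function_assumption P mu H alpha b : Prop :=
  exists rho : 'cV[R]_n.+1 -> 'cV[R]_D,
  exists2 L2 : R, 0 < L2 &
  forall x, int_simplex x -> `|rho x| <= L2 * (1 + `|x|) /\
    forall pi, stationary (srrw_kernel P mu alpha x) pi ->
    [/\ \sum_i pi i 0 *: H (rho x) i = 0,
        forall i, differentiable (H^~ i) (rho x) &
        hurwitz (\sum_i pi i 0 *: nabla (H^~ i) (rho x) + (half_ind b)%:M)].

(* The compact set may depend on the outcome w. *)
Definition stable P mu H alpha a b : Prop :=
  forall theta0 x0 X0, int_simplex x0 ->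
  forall (d : measure_display) (T : measurableType d) (Pr : probability T R)
    (X : nat -> T -> 'I_n.+1),
  srrw_process P mu alpha a x0 X0 Pr X ->
  \forall w \ae Pr,
    (exists2 C : set 'cV[R]_D, compact C &
       forall k, C (theta_iter b H theta0 (X^~ w) k)) /\
    (exists2 C : set 'cV[R]_n.+1, compact C /\ C `<=` int_simplex &
       forall k, C (x_iter a x0 (X^~ w) k)).

Definition setting_i P mu H alpha a b : Prop :=
  [/\ step_exponents a b /\ a < b, regular_growth H,
      root_assumption mu H b & stable P mu H alpha a b].

Definition setting_iii P mu H alpha a b : Prop :=
  [/\ step_exponents a b /\ b < a, regular_growth H,
      root_function_assumption P mu H alpha b & stable P mu H alpha a b].

Definition H_mx H theta : 'M[R]_(n.+1, D) := \matrix_(i, j) H theta i j 0.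

Section Covariances.
Variables (mu : 'cV[R]_n.+1) (lambda : 'I_n.+1 -> R).
Variables (u : 'I_n.+1 -> 'cV[R]_n.+1).
Variables (H : 'cV[R]_D -> 'I_n.+1 -> 'cV[R]_D) (theta : 'cV[R]_D).

Definition U_theta alpha : 'M[R]_D :=
  \sum_(i < n.+1 | i != ord_max)
    (1 / (alpha * (1 + lambda i) + 1) ^+ 2 * ((1 + lambda i) / (1 - lambda i)))
      *: ((H_mx H theta)^T *m u i *m (u i)^T *m H_mx H theta).

Definition U11 : 'M[R]_D :=
  \sum_(i < n.+1 | i != ord_max)
    ((1 + lambda i) / (1 - lambda i))
      *: ((H_mx H theta)^T *m u i *m (u i)^T *m H_mx H theta).

Definition V1 b alpha : 'M[R]_D :=
  let A := nabla (mean_field mu H) theta + (half_ind b)%:M in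
  integral0y_mx (fun t => expmx (t *: A) *m U_theta alpha *m expmx (t *: A^T)).

(* In this time-scale regime the formula for the covariance is independent of
   the self-repellence parameter. *)
Definition V3 alpha : 'M[R]_D :=
  let A := nabla (mean_field mu H) theta in
  integral0y_mx (fun t => expmx (t *: A) *m U11 *m expmx (t *: A^T)).

End Covariances.
End Algorithm.

(* Main.v *)
(** Since b < a3 <= 1, the shift 1_{b=1}/2 vanishes and both covariances are
    integrals of [exp(tA) U exp(tA^T)] with the same Hurwitz matrix A.
    Their difference is the integral for U11 - U_theta(alpha), a combination of
    the rank-one matrices [H^T u_i u_i^T H], i < N, with positive weights.
    It is nonzero: [H^T u_N = H^T mu = h(theta) = 0] and the u_i form a basis,
    so if all the other [H^T u_i] vanished H would be zero.  Positivity
    passes to the integral because the integrand at t = 0 is U11 - U_theta.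

    Convergence needs the exponential decay of [exp(tA)].  A complex Schur
    triangularization, conjugated by [diag(e^k)] with e small, makes the
    off-diagonal part negligible against the negative real parts on the
    diagonal; the squared norm in these coordinates is a Lyapunov function. *)

From HB Require Import structures.
Require Import Defs.
From mathcomp Require Import all_boot all_order all_algebra.
From mathcomp Require Import spectral complex ring lra.
From mathcomp Require Import all_classical all_reals all_analysis.
From mathcomp Require Import measurable_realfun.
Import Order.TTheory GRing.Theory Num.Theory.
Import numFieldNormedType.Exports.
Local Open Scope classical_set_scope.
Local Open Scope ring_scope.

(* The library gives matrices both a complete and a normed structure, but not
   their join. *)
HB.instance Definition _ (R : realType) p q := Complete.on 'M[R]_(p, q).

(** * The matrix exponential entry by entry: convergence, derivative, transpose *)

Section MatrixExponential.
Context {R : realType} {m : nat}.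
Implicit Types (A : 'M[R]_m) (t : R).

Lemma mx_norm_le p q (M : 'M[R]_(p, q)) (b : R) :
  0 <= b -> (forall i j, `|M i j| <= b) -> `|M| <= b.
Proof.
move=> b0 Mb; rewrite /Num.Def.normr/= mx_normrE.
by apply: bigmax_le => // -[i j] _; exact: Mb.
Qed.

Lemma mx_norm_ge p q (M : 'M[R]_(p, q)) i j : `|M i j| <= `|M|.
Proof.
rewrite [leRHS]/Num.Def.normr/= mx_normrE.
exact: (le_bigmax _ (fun ij : 'I_p * 'I_q => `|M ij.1 ij.2|) (i, j)).
Qed.

(** The norm is the largest absolute entry, so each matrix product costs a factor m. *)
Lemma normr_expr_mx A k i j : `|(A ^+ k) i j| <= (m%:R * `|A|) ^+ k.
Proof.
elim: k i j => [|k IH] i j.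
  by rewrite !expr0 mxE; case: (_ == _); rewrite ?normr1 ?normr0.
rewrite exprS -mulmxE mxE (le_trans (ler_norm_sum _ _ _))//.
apply: (le_trans (y := \sum_(l < m) `|A| * (m%:R * `|A|) ^+ k)).
  by apply: ler_sum => l _; rewrite normrM ler_pM// ?mx_norm_ge.
by rewrite sumr_const card_ord exprS -mulrA [leRHS]mulr_natl.
Qed.

Lemma exprZ_mx A t k : (t *: A) ^+ k = t ^+ k *: A ^+ k.
Proof.
elim: k => [|k IH]; first by rewrite !expr0 scale1r.
by rewrite !exprS IH -!mulmxE -scalemxAl -scalemxAr scalerA.
Qed.

(** Power series coefficients of the (i, j) entry of A^d exp(tA), which is the d-th derivative in t
    of the entry of exp(tA). *)
Definition expmx_coeff d A i j k : R := (A ^+ (d + k)) i j / k`!%:R.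

Lemma normr_expmx_term d A i j t k :
  `|expmx_coeff d A i j k * t ^+ k| <=
  (m%:R * `|A|) ^+ d * exp_coeff (m%:R * `|A| * `|t|) k.
Proof.
rewrite /exp_coeff /expmx_coeff /= !normrM normrX [(_ * `|t|) ^+ k]exprMn.
rewrite normfV normr_nat !mulrA -exprD mulrAC ler_wpM2r//.
by rewrite ler_wpM2r ?exprn_ge0// normr_expr_mx.
Qed.

Lemma is_cvg_expmx_coeff d A i j t : cvgn (pseries (expmx_coeff d A i j) t).
Proof.
apply: normed_cvg.
apply: (series_le_cvg (v_ := (m%:R * `|A|) ^+ d *:
  exp_coeff (m%:R * `|A| * `|t|))) => [k|k|k|].
- exact: normr_ge0.
- by apply: mulr_ge0; rewrite ?exp_coeff_ge0 ?exprn_ge0 ?mulr_ge0.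
- exact: normr_expmx_term.
by apply: is_cvg_seriesZ; exact: is_cvg_series_exp_coeff.
Qed.

Lemma is_cvg_expmx A t :
  cvgn (series (fun k => (k`!%:R)^-1 *: (t *: A) ^+ k)).
Proof.
apply: normed_cvg.
apply: (series_le_cvg _ _ _
  (is_cvg_series_exp_coeff (m%:R * `|A| * `|t|))) => k /=.
- exact: normr_ge0.
- by rewrite exp_coeff_ge0// !mulr_ge0.
apply: mx_norm_le => [|i j]; first by rewrite exp_coeff_ge0// !mulr_ge0.
have := normr_expmx_term 0 A i j t k; rewrite expr0 mul1r; apply: le_trans.
suff -> : ((k`!%:R)^-1 *: (t *: A) ^+ k) i j =
  expmx_coeff 0 A i j k * t ^+ k by [].
by rewrite exprZ_mx !mxE /expmx_coeff; ring.
Qed.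

Lemma expmxE A i j t :
  expmx (t *: A) i j = limn (pseries (expmx_coeff 0 A i j) t).
Proof.
apply/esym/cvg_lim => //.
have := cvg_comp _ _ (is_cvg_expmx A t)
  (@coord_continuous R m m i j _).
apply: cvg_trans; apply: near_eq_cvg; near=> N.
rewrite /= /pseries /series/= summxE; apply: eq_bigr => k _.
by rewrite exprZ_mx !mxE /expmx_coeff; ring.
Unshelve. all: by end_near. Qed.

Lemma pseries_diffs_expmx_coeff d A i j :
  pseries_diffs (expmx_coeff d A i j) = expmx_coeff d.+1 A i j.
Proof.
apply/funext => k; rewrite /pseries_diffs /expmx_coeff factS natrM addnS.
by rewrite invfM mulrCA mulVKf ?pnatr_eq0.
Qed.

(** Splitting one factor A off A^(k+1) lets the differentiated series be recognised as A exp(tA). *)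
Lemma pseries_expmx_coeff1 A i j t :
  pseries (expmx_coeff 1 A i j) t =
  \sum_(l < m) (A i l *: pseries (expmx_coeff 0 A l j) t).
Proof.
apply/funext => N; rewrite fct_sumE.
transitivity (\sum_(l < m) \sum_(0 <= k < N)
    A i l * (expmx_coeff 0 A l j k * t ^+ k)); last first.
  by apply: eq_bigr => l _; rewrite -mulr_sumr.
rewrite /pseries /series/= exchange_big/=; apply: eq_bigr => k _.
rewrite /expmx_coeff add1n add0n exprS -mulmxE mxE !mulr_suml.
by apply: eq_bigr => l _; ring.
Qed.

Lemma cvg_pseries_expmx_coeff1 A i j t :
  pseries (expmx_coeff 1 A i j) t @ \oo --> (A *m expmx (t *: A)) i j.
Proof.
rewrite pseries_expmx_coeff1 mxE fct_sumE.
apply: cvg_big => [|l _]; first by move=> x; exact: add_continuous.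
by rewrite expmxE; apply: cvgZr; exact: is_cvg_expmx_coeff.
Qed.

Lemma is_derive_expmx A i j t :
  is_derive t 1 (fun s : R => expmx (s *: A) i j) ((A *m expmx (t *: A)) i j).
Proof.
rewrite [X in is_derive _ _ X](_ : _ =
  fun s => limn (pseries (expmx_coeff 0 A i j) s)); last first.
  by apply/funext => s; rewrite expmxE.
rewrite -(cvg_lim _ (cvg_pseries_expmx_coeff1 A i j t))//.
rewrite -pseries_diffs_expmx_coeff.
(* Any radius beyond |t| serves. The convergence conditions concern the series and its first two
   formal derivatives, the shifts d = 0, 1, 2. *)
apply: (@pseries_snd_diffs _ _ (`|t| + 1)); rewrite ?pseries_diffs_expmx_coeff.
- exact: is_cvg_expmx_coeff.
- exact: is_cvg_expmx_coeff.
- exact: is_cvg_expmx_coeff.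
- by rewrite [ltRHS]ger0_norm ?addr_ge0// ltrDl.
Qed.

Lemma continuous_expmx A i j : continuous (fun t : R => expmx (t *: A) i j).
Proof.
move=> t; apply/differentiable_continuous/derivable1_diffP.
by have [] := is_derive_expmx A i j t.
Qed.

Lemma expmx0 : expmx (0 : 'M[R]_m) = 1%:M.
Proof.
apply/cvg_lim => //; apply: cvg_near_cst; exists 1%N => // -[//|N] _.
rewrite /series/= big_nat_recl//= expr0 fact0 invr1 scale1r.
rewrite big1 ?addr0// => k _.
by rewrite expr0n/= scaler0.
Qed.

Lemma expmx_tr A t : expmx (t *: A^T) = (expmx (t *: A))^T.
Proof.
apply/matrixP => i j; rewrite [RHS]mxE !expmxE; congr (limn (pseries _ t)).
apply/funext => k; rewrite /expmx_coeff; congr (_ / _).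
suff -> : A^T ^+ k = (A ^+ k)^T by rewrite mxE.
elim: k => [|k IH]; first by rewrite !expr0 trmx1.
by rewrite exprS exprSr IH -!mulmxE trmx_mul.
Qed.
End MatrixExponential.

(** * Lyapunov function of a Hurwitz matrix and exponential decay of exp(tA) *)

Section Lyapunov.
Context {R : realType}.
Local Notation re := (@complex.Re R).
Local Notation im := (@complex.Im R).
Local Open Scope sesquilinear_scope.

Lemma Re_sum (I : Type) (r : seq I) (Q : pred I) (F : I -> R[i]) :
  re (\sum_(i <- r | Q i) F i) = \sum_(i <- r | Q i) re (F i).
Proof. by apply: big_morph => // -[a b] [c d]. Qed.

Lemma Im_sum (I : Type) (r : seq I) (Q : pred I) (F : I -> R[i]) :
  im (\sum_(i <- r | Q i) F i) = \sum_(i <- r | Q i) im (F i).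
Proof. by apply: big_morph => // -[a b] [c d]. Qed.

Lemma ReM (x y : R[i]) :
  re (x * y) = re x * re y - im x * im y.
Proof. by case: x y => [a b] [c d]. Qed.

Lemma ImM (x y : R[i]) :
  im (x * y) = re x * im y + im x * re y.
Proof. by case: x y => [a b] [c d]. Qed.

Lemma Re_mulmx p q r (M : 'M[R[i]]_(p, q)) (N : 'M[R[i]]_(q, r)) :
  map_mx re (M *m N) =
  map_mx re M *m map_mx re N -
  map_mx im M *m map_mx im N.
Proof.
apply/matrixP => i j; rewrite !mxE Re_sum -sumrB; apply: eq_bigr => k _.
by rewrite ReM !mxE.
Qed.

Lemma Im_mulmx p q r (M : 'M[R[i]]_(p, q)) (N : 'M[R[i]]_(q, r)) :
  map_mx im (M *m N) =
  map_mx re M *m map_mx im N +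
  map_mx im M *m map_mx re N.
Proof.
apply/matrixP => i j; rewrite !mxE Im_sum -big_split/=; apply: eq_bigr => k _.
by rewrite ImM !mxE.
Qed.

(* X + iY is the unitary matrix and T1 + iT2 the lower triangular one. *)
Lemma hurwitz_schur m (A : 'M[R]_m) : hurwitz A ->
  exists X Y T1 T2 : 'M[R]_m,
  [/\ X *m A = T1 *m X - T2 *m Y, Y *m A = T1 *m Y + T2 *m X,
      X^T *m X + Y^T *m Y = 1%:M,
      forall k l : 'I_m, (k < l)%N -> T1 k l = 0 /\ T2 k l = 0 &
      forall k, T1 k k < 0].
Proof.
(* Schur triangularization asks for positive size; size 0 is settled by empty matrices. *)
case: m A => [|m] A hA.
  exists 0, 0, 0, 0; rewrite !mul0mx subr0 addr0; split => //;
    by [apply/matrixP => -[]|case].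
have [P Pu PA] := Schur (map_mx (real_complex R) A) (ltn0Sn m).
have : is_trig_mx (conjmx P (map_mx (real_complex R) A)) by exact: PA.
rewrite conjymx// => Ttrig.
set T := _ *m _ in Ttrig.
have PP : P ^t* *m P = 1%:M by apply/mulmx1C/unitarymxP.
have TP : T *m P = P *m map_mx (real_complex R) A.
  by rewrite /T -mulmxA PP mulmx1.
have ReA : map_mx re (map_mx (real_complex R) A) = A.
  by apply/matrixP => i j; rewrite !mxE.
have ImA : map_mx im (map_mx (real_complex R) A) = 0.
  by apply/matrixP => i j; rewrite !mxE.
exists (map_mx re P), (map_mx im P).
exists (map_mx re T), (map_mx im T); split.
- by rewrite -Re_mulmx TP Re_mulmx ReA ImA mulmx0 subr0.
- by rewrite -Im_mulmx TP Im_mulmx ReA ImA mulmx0 add0r.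
- have := congr1 (map_mx re) PP; rewrite Re_mulmx.
  have -> : map_mx re (P ^t*) = (map_mx re P)^T.
    by apply/matrixP => i j; rewrite !mxE; case: (P j i).
  have -> : map_mx im (P ^t*) = - (map_mx im P)^T.
    by apply/matrixP => i j; rewrite !mxE; case: (P j i).
  rewrite mulNmx opprK => ->.
  by apply/matrixP => i j; rewrite !mxE; case: (_ == _).
- by move=> k l kl; rewrite 2![map_mx _ _ k l]mxE (is_trig_mxP Ttrig).
move=> k; rewrite mxE; apply: hA.
(* A diagonal entry of a triangular matrix is an eigenvalue, and T P = P A turns a left eigenvector
   v of T into the left eigenvector v P of A. *)
have /eigenvalueP[v vT v0] : eigenvalue T (T k k).
  rewrite eigenvalue_root_char char_poly_trig// /root horner_prod.
  by rewrite (bigD1 k)//= hornerXsubC subrr mul0r.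
apply/eigenvalueP; exists (v *m P).
  by rewrite -mulmxA -TP mulmxA vT scalemxAl.
apply: contra v0 => /eqP vP0.
by rewrite -[v]mulmx1 -(unitarymxP Pu) mulmxA vP0 mul0mx.
Qed.

(* The left-hand side is the real part of conj(p + iq) (a + ib) (p' + iq'). *)
Lemma rotation_form_le (a b d p q p' q' : R) : `|a| <= d -> `|b| <= d ->
  p * (a * p' - b * q') + q * (a * q' + b * p') <=
  d * ((p ^+ 2 + q ^+ 2) + (p' ^+ 2 + q' ^+ 2)).
Proof.
move=> ad bd; have d0 : 0 <= d := le_trans (normr_ge0 _) ad.
pose S := p ^+ 2 + q ^+ 2 + (p' ^+ 2 + q' ^+ 2).
have H (c z : R) : `|c| <= d -> `|z| <= S / 2 -> c * z <= d * (S / 2).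
  by move=> cd zd; rewrite (le_trans (ler_norm _))// normrM ler_pM.
(* Grouping by a and b leaves, up to sign, the real and imaginary parts of conj(p + iq) (p' + iq'),
   each at most S / 2 in absolute value. *)
have h1 : a * (p * p' + q * q') <= d * (S / 2).
  apply: H => //; rewrite ler_norml /S; apply/andP; split.
    by have := sqr_ge0 (p + p'); have := sqr_ge0 (q + q'); lra.
  by have := sqr_ge0 (p - p'); have := sqr_ge0 (q - q'); lra.
have h2 : b * (q * p' - p * q') <= d * (S / 2).
  apply: H => //; rewrite ler_norml /S; apply/andP; split.
    by have := sqr_ge0 (q + p'); have := sqr_ge0 (p - q'); lra.
  by have := sqr_ge0 (q - p'); have := sqr_ge0 (p + q'); lra.
rewrite -/S; lra.
Qed.

(** Including 1 in the minimum covers an empty index type. *)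
Lemma exists_pos_lower_bound (I : finType) (f : I -> R) :
  (forall i, 0 < f i) -> exists2 c : R, 0 < c & forall i, c <= f i.
Proof.
move=> f0; exists (\big[Num.min/1]_i f i); first by apply/bigmin_gtP.
by move=> i; exact: bigmin_le_cond.
Qed.

(** [L] stacks the real and imaginary parts of the rescaled Schur coordinates. The last inequality
    bounds half the derivative of |Lx|^2 along x' = Ax. *)
Lemma hurwitz_lyapunov m (A : 'M[R]_m) : hurwitz A ->
  exists (L : 'M[R]_(m + m, m)) (c kappa : R),
  [/\ 0 < c, 0 < kappa,
      forall x : 'cV[R]_m,
        kappa * (\sum_l x l 0 ^+ 2) <= \sum_k (L *m x) k 0 ^+ 2 &
      forall x : 'cV[R]_m,
        \sum_k (L *m x) k 0 * (L *m (A *m x)) k 0 <=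
        - c * \sum_k (L *m x) k 0 ^+ 2].
Proof.
move=> /hurwitz_schur[X [Y [T1 [T2 [XA YA XY trig diag]]]]].
have [|c0 c0_gt0 c0_le] := @exists_pos_lower_bound 'I_m (fun k => - T1 k k).
  by move=> k; rewrite oppr_gt0.
pose M := `|T1| + `|T2| + 1.
have M_gt0 : 0 < M by rewrite ltr_wpDl// addr_ge0.
(* The target size of a rescaled off-diagonal entry: the total error 2md is at most c0 / 2. Using m
   + 1 avoids dividing by zero when m = 0. *)
pose d := c0 / (4 * m.+1%:R).
have d_gt0 : 0 < d by rewrite divr_gt0// mulr_gt0.
(* Chosen so that both e <= 1 and eM <= d hold. *)
pose e := d / (d + M).
have dM_gt0 : 0 < d + M by exact: addr_gt0.
have e_gt0 : 0 < e by exact: divr_gt0.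
have e_le1 : e <= 1 by rewrite /e ler_pdivrMr// mul1r lerDl ltW.
have eM : e * M <= d.
  by rewrite /e mulrAC ler_pdivrMr// [leRHS]mulrDr lerDr ltW// mulr_gt0.
have TM k l : `|T1 k l| <= M /\ `|T2 k l| <= M.
  have := mx_norm_ge _ _ T1 k l; have := mx_norm_ge _ _ T2 k l.
  have := normr_ge0 T1; have := normr_ge0 T2; rewrite /M; lra.
have dm : 4 * m%:R * d <= c0.
  rewrite /d mulrCA ger_pMr// ler_pdivrMr ?mulr_gt0// mul1r.
  by rewrite ler_pM2l// ler_nat.
clearbody e d M.
pose E := diag_mx (\row_(k < m) e ^+ k).
have EE p (N : 'M[R]_(m, p)) k j : (E *m N) k j = e ^+ k * N k j.
  by rewrite mul_diag_mx !mxE.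
exists (col_mx (E *m X) (E *m Y)), (c0 / 2), (e ^+ m ^+ 2); split.
- by rewrite divr_gt0.
- by rewrite !exprn_gt0.
- move=> x.
  (* The unitary change of coordinates preserves the norm; the rescaling then shrinks coordinate k
     by e^k >= e^m, whence kappa = e^(2m). *)
  have <- : \sum_k ((X *m x) k 0 ^+ 2 + (Y *m x) k 0 ^+ 2) = \sum_l x l 0 ^+ 2.
    have := congr1 (fun N => (x^T *m N *m x) 0 0) XY.
    rewrite mulmx1 mulmxDr mulmxDl !mulmxA -!trmx_mul -!mulmxA !mxE.
    rewrite -big_split/= => H.
    transitivity (\sum_(i < m) x^T 0 i * x i 0); last first.
      by apply: eq_bigr => i _; rewrite mxE expr2.
    by rewrite -H; apply: eq_bigr => i _; rewrite ![_^T 0 i]mxE !expr2.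
  rewrite big_split_ord/= -big_split/= mulr_sumr; apply: ler_sum => k _.
  rewrite mul_col_mx col_mxEu col_mxEd -!mulmxA !EE !exprMn -mulrDr.
  rewrite ler_wpM2r ?addr_ge0 ?sqr_ge0//.
  by rewrite lerXn2r ?nnegrE ?exprn_ge0 ?ler_wiXn2l ?(ltW e_gt0)// ltnW.
move=> x; rewrite 2!big_split_ord/= -!big_split/=.
set p := X *m x; set q := Y *m x.
have Xk k : (E *m X *m (A *m x)) k 0 =
    e ^+ k * \sum_l (T1 k l * p l 0 - T2 k l * q l 0).
  rewrite -mulmxA EE mulmxA XA mulmxBl -!mulmxA !mxE sumrB.
  by congr (_ * (_ - _)); apply: eq_bigr.
have Yk k : (E *m Y *m (A *m x)) k 0 =
    e ^+ k * \sum_l (T1 k l * q l 0 + T2 k l * p l 0).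
  rewrite -mulmxA EE mulmxA YA mulmxDl -!mulmxA !mxE big_split/=.
  by congr (_ * (_ + _)); apply: eq_bigr.
(* [r k] is the squared modulus of the k-th rescaled coordinate; [g k l] below is the contribution
   of the entry (k, l) of T1 + iT2. *)
pose r (k : 'I_m) := (e ^+ k * p k 0) ^+ 2 + (e ^+ k * q k 0) ^+ 2.
have r_ge0 k : 0 <= r k by rewrite addr_ge0 ?sqr_ge0.
pose g (k l : 'I_m) :=
  e ^+ k * p k 0 * (e ^+ k * (T1 k l * p l 0 - T2 k l * q l 0)) +
  e ^+ k * q k 0 * (e ^+ k * (T1 k l * q l 0 + T2 k l * p l 0)).
have g_le k l : g k l <= (k == l)%:R * (- c0 * r k) + d * (r k + r l).
  (* Above the diagonal the entry is zero. Below it, rescaling multiplies the entry by e^(k - l) <=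
     e, making it at most d. On it, the real part is at most -c0 and the imaginary part cancels. *)
  have [kl|lk|/val_inj <-] := ltngtP k l.
  - have [T10 T20] := trig _ _ kl.
    have -> : (k == l) = false by rewrite -val_eqE/= ltn_eqF.
    rewrite /g T10 T20 !mul0r subrr addr0 !mulr0 addr0 add0r.
    by rewrite mulr_ge0 ?(ltW d_gt0)// addr_ge0.
  - rewrite (negbTE (_ : k != l)) -?val_eqE/= ?gtn_eqF// mul0r add0r.
    have ekl : e ^+ k = e ^+ (k - l) * e ^+ l by rewrite -exprD subnK// ltnW.
    have se : 0 <= e ^+ (k - l) <= e.
      rewrite exprn_ge0 ?(ltW e_gt0)//= -[leRHS]expr1 ler_wiXn2l ?(ltW e_gt0)//.
      by rewrite subn_gt0.
    have sT z : `|z| <= M -> `|e ^+ (k - l) * z| <= d.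
      move=> zM; case/andP: se => s0 se; apply: le_trans eM.
      by rewrite normrM ger0_norm// ler_pM.
    have [T1M T2M] := TM k l.
    have := rotation_form_le _ _ _ (e ^+ k * p k 0) (e ^+ k * q k 0)
      (e ^+ l * p l 0) (e ^+ l * q l 0) (sT _ T1M) (sT _ T2M).
    rewrite -/(r k) -/(r l); apply: le_trans.
    by rewrite le_eqVlt; apply/orP; left; apply/eqP; rewrite /g ekl; ring.
  - rewrite eqxx mul1r.
    have -> : g k k = T1 k k * r k by rewrite /g /r; ring.
    have dr : 0 <= d * (r k + r k) by rewrite mulr_ge0 ?(ltW d_gt0)// addr_ge0.
    by rewrite ler_wpDr// ler_wpM2r// lerNr c0_le.
rewrite [leLHS](_ : _ = \sum_k \sum_l g k l); last first.
  apply: eq_bigr => k _; rewrite !mul_col_mx !col_mxEu !col_mxEd Xk Yk.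
  rewrite -!mulmxA !EE !mulrA !mulr_sumr -big_split/=; apply: eq_bigr => l _.
  by rewrite /g !mulrA.
rewrite [X in _ * X](_ : _ = \sum_k r k); last first.
  apply: eq_bigr => k _; rewrite !mul_col_mx !col_mxEu !col_mxEd.
  by rewrite -!mulmxA !EE.
apply: (le_trans (y := \sum_k \sum_l
  ((k == l)%:R * (- c0 * r k) + d * (r k + r l)))).
  by apply: ler_sum => k _; apply: ler_sum => l _.
set S := \sum_k r k.
(* Summing d (r k + r l) over all pairs gives 2mdS, and [dm] absorbs it into half of c0 S. *)
rewrite [leLHS](_ : _ = (2 * m%:R * d - c0) * S).
  have S0 : 0 <= S by apply: sumr_ge0.
  by rewrite ler_wpM2r//; lra.
transitivity (\sum_k (- c0 * r k + d * (m%:R * r k + S))).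
  apply: eq_bigr => k _; rewrite big_split/= (bigD1 k)//= eqxx mul1r big1.
    rewrite addr0 -mulr_sumr big_split/= sumr_const card_ord.
    by rewrite -(mulr_natl (r k)).
  by move=> l /negbTE lk; rewrite eq_sym lk mul0r.
rewrite big_split/= -!mulr_sumr [X in d * X]big_split/= -mulr_sumr.
by rewrite sumr_const card_ord -/S -(mulr_natl S); ring.
Qed.

(** The product V(t) e^(ct) has nonpositive derivative, hence does not increase. *)
Lemma gronwall_decay (V dV : R -> R) (c : R) :
  (forall t : R, is_derive t 1 V (dV t)) -> (forall t, dV t <= - c * V t) ->
  forall t, 0 <= t -> V t <= V 0 * expR (- c * t).
Proof.
move=> VdV dVle t t0.
pose W t := V t * expR (c * t).
have WdW (s : R) : is_derive s (1 : R) W ((dV s + c * V s) * expR (c * s)).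
  have h1 : is_derive s (1 : R) (c *: (@id R)) c.
    by apply: is_derive_eq; rewrite /GRing.scale/= mulr1.
  have h2 : is_derive s (1 : R) (fun x : R => expR (c * x)) (c * expR (c * s)).
    by rewrite mulrC; exact: is_derive1_comp.
  have h := is_deriveM (VdV s) h2; apply: is_derive_eq.
  by rewrite /GRing.scale/=; ring.
have W_le : W t <= W 0.
  apply: (@ler0_derive1_nincry _ W 0) => //.
    move=> x _; rewrite derive1E (@derive_val _ _ _ _ _ _ _ (WdW x)).
    by rewrite mulr_le0_ge0 ?expR_ge0// -lerBrDr sub0r -mulNr.
  apply: continuous_subspaceT => x.
  by apply/differentiable_continuous/derivable1_diffP; case: (WdW x).
rewrite mulNr expRN ler_pdivlMr ?expR_gt0//.
by move: W_le; rewrite /W mulr0 expR0 mulr1.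
Qed.

(** Each column of exp(tA) solves y' = Ay, so the Lyapunov function decays along it and, through
    kappa, controls its entries. *)
Lemma hurwitz_expmx_decay m (A : 'M[R]_m) : hurwitz A ->
  exists c K : R, [/\ 0 < c, 0 <= K &
    forall t i j, 0 <= t -> expmx (t *: A) i j ^+ 2 <= K * expR (- c * t)].
Proof.
move=> /hurwitz_lyapunov[L [c [kappa [c0 k0 Lge Lle]]]].
pose V j (t : R) := \sum_k (L *m expmx (t *: A)) k j ^+ 2.
pose dV j (t : R) := \sum_k (2 * ((L *m expmx (t *: A)) k j *
  (L *m (A *m expmx (t *: A))) k j)).
have VdV j (t : R) : is_derive t (1 : R) (V j) (dV j t).
  have h k : is_derive t (1 : R) (fun s : R => (L *m expmx (s *: A)) k j)
      ((L *m (A *m expmx (t *: A))) k j).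
    rewrite [X in is_derive _ _ X](_ : _ =
      \sum_l (L k l *: (fun s : R => expmx (s *: A) l j))); last first.
      by apply/funext => s; rewrite fct_sumE mxE.
    rewrite [X in is_derive _ _ _ X]mxE; apply: is_derive_sum => l.
    by apply: is_deriveZ; exact: is_derive_expmx.
  rewrite [X in is_derive _ _ X](_ : _ =
    \sum_k (fun s : R => (L *m expmx (s *: A)) k j) ^+ 2); last first.
    by apply/funext => s; rewrite fct_sumE.
  apply: is_derive_sum => k; apply: is_derive_eq.
  by rewrite expr1 /GRing.scale/= -mulr_natl mulrA.
have colE p (N : 'M[R]_(p, m)) (B : 'M[R]_m) k j :
    (N *m B) k j = (N *m col j B) k 0.
  by rewrite !mxE; apply: eq_bigr => l _; rewrite mxE.
have dVle j t : dV j t <= - (2 * c) * V j t.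
  rewrite /dV -mulr_sumr -mulrN -mulrA ler_pM2l//.
  have := Lle (col j (expmx (t *: A))).
  under eq_bigr do rewrite mulmxA -!colE -mulmxA.
  by under [X in _ <= _ * X -> _]eq_bigr do rewrite -colE.
have Vge0 l : 0 <= V l 0 by apply: sumr_ge0 => k _; exact: sqr_ge0.
(* Summing the initial values over all columns makes the constant independent of j. *)
exists (2 * c), (\sum_j V j 0 / kappa); split; first exact: mulr_gt0.
  by apply: sumr_ge0 => j _; apply: divr_ge0; last exact: ltW.
move=> t i j t0.
have Vd := gronwall_decay _ _ _ (VdV j) (dVle j) t t0.
apply: (le_trans (y := V j t / kappa)).
  rewrite ler_pdivlMr// mulrC.
  have := Lge (col j (expmx (t *: A))).
  under [X in _ <= X -> _]eq_bigr do rewrite -colE.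
  apply: le_trans; rewrite ler_pM2l// (bigD1 i)//= mxE lerDl.
  by apply: sumr_ge0 => k _; exact: sqr_ge0.
apply: (le_trans (y := V j 0 / kappa * expR (- (2 * c) * t))).
  by rewrite mulrAC ler_wpM2r// invr_ge0 ltW.
rewrite ler_wpM2r ?expR_ge0// (bigD1 j)//= lerDl.
by apply: sumr_ge0 => l _; apply: divr_ge0; last exact: ltW.
Qed.

End Lyapunov.

(** * Integrability, finite sums and strict positivity of integrals over the half-line *)

Section HalfLineIntegral.
Context {R : realType}.
Local Notation leb := (@lebesgue_measure R).

Lemma integrable_exp_decay (f : R -> R) (c K : R) : 0 < c ->
  continuous f -> (forall t, 0 <= t -> `|f t| <= K * expR (- c * t)) ->
  leb.-integrable `[0, +oo[ (EFin \o f).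
Proof.
move=> c0 cf fK.
(* The dominating function is K / c times the exponential density c e^(-ct). *)
have gint : leb.-integrable `[0, +oo[
    (fun t => ((K / c)%:E * (exponential_pdf c t)%:E)%E).
  apply: integrableZl => //.
  apply: (@integrableS _ _ _ leb setT) => //.
  exact: integrable_exponential_pdf.
apply: le_integrable gint => //.
  apply/measurable_EFinP; apply: measurable_funTS.
  exact: continuous_measurable_fun.
move=> t /=; rewrite in_itv/= andbT => t0.
rewrite lee_fin exponential_pdfE// mulrA divfK ?gt_eqF//.
by rewrite (le_trans (fK _ t0))// ler_norm.
Qed.

Lemma integrable_sum_EFin (I : Type) (s : seq I) (D : set R) (f : I -> R -> R) :
  measurable D -> (forall i, leb.-integrable D (EFin \o f i)) ->
  leb.-integrable D (EFin \o (fun t => \sum_(i <- s) f i t)).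
Proof.
move=> mD fint.
rewrite [X in leb.-integrable _ X](_ : _ =
  fun t => (\sum_(i <- s) (EFin \o f i) t)%E); first exact: integrable_sum.
by apply/funext => t /=; rewrite sumEFin.
Qed.

Lemma Rintegral_sum (I : Type) (s : seq I) (D : set R) (f : I -> R -> R) :
  measurable D -> (forall i, leb.-integrable D (EFin \o f i)) ->
  \int[leb]_(t in D) (\sum_(i <- s) f i t) =
  \sum_(i <- s) \int[leb]_(t in D) f i t.
Proof.
move=> mD fint; elim: s => [|i s IH].
  under eq_Rintegral do rewrite big_nil.
  by rewrite big_nil Rintegral_cst// mul0r.
under eq_Rintegral do rewrite big_cons.
by rewrite big_cons -IH RintegralD//; exact: integrable_sum_EFin.
Qed.

Lemma Rintegral_gt0 (f : R -> R) :
  leb.-integrable `[0, +oo[ (EFin \o f) -> continuous f ->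
  (forall t, 0 <= f t) -> 0 < f 0 -> 0 < \int[leb]_(t in `[0, +oo[) f t.
Proof.
move=> fint cf f_ge0 f0.
have mf (D : set R) : measurable D -> measurable_fun D (EFin \o f).
  move=> mD; apply/measurable_EFinP; apply: measurable_funTS.
  exact: continuous_measurable_fun.
have /cvgrPdist_lt/(_ (f 0 / 2)) := cf 0.
rewrite divr_gt0// => /(_ isT)/nbhs_ballP[d/= d0 dP].
(* [fine] sends an infinite value to 0, so finiteness of the integral is part of the goal. *)
rewrite /Rintegral fine_gt0//; apply/andP; split; last first.
  by rewrite ltey_eq; apply/orP; left; exact: integrable_fin_num.
(* By continuity f exceeds f(0) / 2 on [0, d / 2], and this piece alone has positive integral. *)
apply: (@lt_le_trans _ _ (\int[leb]_(t in `[0%R, (d / 2)%R]) (f 0 / 2)%:E)%E).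
  rewrite integral_cst//= lebesgue_measure_itv/= lte_fin divr_gt0//.
  by rewrite -EFinB subr0 -EFinM lte_fin mulr_gt0// divr_gt0.
apply: (@le_trans _ _ (\int[leb]_(t in `[0%R, (d / 2)%R]) (f t)%:E)%E).
  apply: ge0_le_integral => //.
  - by move=> t t0; rewrite lee_fin divr_ge0// ltW.
  - exact: mf.
  move=> t /=; rewrite in_itv/= => /andP[t0 td].
  have /dP : ball (0 : R) d t.
    rewrite /ball/= sub0r normrN ger0_norm// (le_lt_trans td)//.
    by rewrite ltr_pdivrMr// ltr_pMr// ltr1n.
  by rewrite /= ltr_norml lee_fin => /andP[_]; lra.
apply: ge0_subset_integral => //=.
- exact: mf.
- by move=> t t0; rewrite lee_fin.
- by move=> t /=; rewrite !in_itv/= => /andP[-> _].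
Qed.

End HalfLineIntegral.

(** * Integrals of exp(tA) M exp(tA^T): symmetry, linearity and positivity *)

Section Sandwich.
Context {R : realType} {m : nat}.
Local Notation leb := (@lebesgue_measure R).
Implicit Types (A M : 'M[R]_m) (x : 'cV[R]_m).

Definition sandwich A M (t : R) : 'M[R]_m :=
  expmx (t *: A) *m M *m expmx (t *: A^T).

Lemma sandwichE A M t i j :
  sandwich A M t i j =
  \sum_l \sum_k (expmx (t *: A) i k * M k l * expmx (t *: A) j l).
Proof.
rewrite /sandwich expmx_tr mxE; apply: eq_bigr => l _.
by rewrite !mxE mulr_suml.
Qed.

Lemma sandwich0 A M : sandwich A M 0 = M.
Proof. by rewrite /sandwich !scale0r expmx0 mul1mx mulmx1. Qed.

Lemma sandwichB A M N t :
  sandwich A (M - N) t = sandwich A M t - sandwich A N t.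
Proof. by rewrite /sandwich mulmxBr mulmxBl. Qed.

Lemma sandwich_sym A M t : M^T = M -> (sandwich A M t)^T = sandwich A M t.
Proof.
by move=> Msym; rewrite /sandwich expmx_tr !trmx_mul trmxK Msym mulmxA.
Qed.

(** The integrand is congruent to M, so nonnegativity of the form of M passes to every t. *)
Lemma sandwich_form A M t x :
  x^T *m sandwich A M t *m x =
  ((expmx (t *: A))^T *m x)^T *m M *m ((expmx (t *: A))^T *m x).
Proof. by rewrite /sandwich expmx_tr trmx_mul trmxK !mulmxA. Qed.

Lemma continuous_sandwich A M i j : continuous (fun t => sandwich A M t i j).
Proof.
move=> t; under eq_fun do rewrite sandwichE.
apply: cvg_big => [|l _]; first by move=> ?; exact: add_continuous.
apply: cvg_big => [|k _]; first by move=> ?; exact: add_continuous.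
apply: cvgM; last exact: continuous_expmx.
by apply: cvgM; [exact: continuous_expmx|exact: cvg_cst].
Qed.

Lemma integrable_sandwich A M i j : hurwitz A ->
  leb.-integrable `[0, +oo[ (EFin \o (fun t => sandwich A M t i j)).
Proof.
move=> /hurwitz_expmx_decay[c [K [c0 K0 AK]]].
apply: (integrable_exp_decay _ c (\sum_l \sum_k (`|M k l| * K))) => //.
  exact: continuous_sandwich.
move=> t t0; rewrite sandwichE (le_trans (ler_norm_sum _ _ _))//.
rewrite mulr_suml; apply: ler_sum => l _.
rewrite (le_trans (ler_norm_sum _ _ _))// mulr_suml; apply: ler_sum => k _.
rewrite !normrM mulrAC mulrC -mulrA ler_wpM2l// -normrM.
(* A product of two entries is at most half the sum of their squares, and each square is at most K
   e^(-ct). *)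
have := AK t i k t0; have := AK t j l t0; rewrite ler_norml.
set a := expmx _ _ _; set b := expmx _ _ _; set z := _ * _ => az bz.
apply/andP; split.
  by have := sqr_ge0 (a + b); lra.
by have := sqr_ge0 (a - b); lra.
Qed.

Lemma integral_sandwich_sym A M : M^T = M ->
  (integral0y_mx (sandwich A M))^T = integral0y_mx (sandwich A M).
Proof.
move=> Msym; apply/matrixP => i j; rewrite !mxE.
apply: eq_Rintegral => t _.
by rewrite -[in RHS](sandwich_sym _ _ _ Msym) [RHS]mxE.
Qed.

Lemma integral_sandwichB A M N : hurwitz A ->
  integral0y_mx (sandwich A (M - N)) =
  integral0y_mx (sandwich A M) - integral0y_mx (sandwich A N).
Proof.
move=> hA; apply/matrixP => i j; rewrite !mxE -RintegralB//.
- by apply: eq_Rintegral => t _; rewrite sandwichB !mxE.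
- exact: integrable_sandwich.
- exact: integrable_sandwich.
Qed.

Lemma quadratic_formE M x :
  (x^T *m M *m x) 0 0 = \sum_j \sum_i (x i 0 * x j 0 * M i j).
Proof.
rewrite mxE; apply: eq_bigr => j _; rewrite mxE mulr_suml.
by apply: eq_bigr => i _; rewrite mxE mulrAC.
Qed.

Lemma continuous_form_sandwich A M x :
  continuous (fun t => (x^T *m sandwich A M t *m x) 0 0).
Proof.
move=> t; under eq_fun do rewrite quadratic_formE.
apply: cvg_big => [|j _]; first by move=> ?; exact: add_continuous.
apply: cvg_big => [|i _]; first by move=> ?; exact: add_continuous.
by apply: cvgM; [exact: cvg_cst|exact: continuous_sandwich].
Qed.

Lemma integrable_term_sandwich A M x i j : hurwitz A ->
  leb.-integrable `[0, +oo[
    (EFin \o (fun t => x i 0 * x j 0 * sandwich A M t i j)).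
Proof.
move=> hA.
have := integrableZl _ (x i 0 * x j 0) (integrable_sandwich A M i j hA).
by apply.
Qed.

Lemma integrable_form_sandwich A M x : hurwitz A ->
  leb.-integrable `[0, +oo[
    (EFin \o (fun t => (x^T *m sandwich A M t *m x) 0 0)).
Proof.
move=> hA; under [X in EFin \o X]eq_fun do rewrite quadratic_formE.
do 2![apply: integrable_sum_EFin => // ?].
exact: integrable_term_sandwich.
Qed.

(** Reduces semi-definiteness and nonvanishing of the entrywise integral to statements on scalar
    integrals. *)
Lemma form_integral_sandwich A M x : hurwitz A ->
  (x^T *m integral0y_mx (sandwich A M) *m x) 0 0 =
  \int[leb]_(t in `[0, +oo[) (x^T *m sandwich A M t *m x) 0 0.
Proof.
move=> hA; rewrite quadratic_formE.
under eq_Rintegral do rewrite quadratic_formE.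
rewrite Rintegral_sum//; last first.
  move=> j; apply: integrable_sum_EFin => // i.
  exact: integrable_term_sandwich.
apply: eq_bigr => j _; rewrite Rintegral_sum//; last first.
  by move=> i; exact: integrable_term_sandwich.
apply: eq_bigr => i _; rewrite mxE RintegralZl//.
exact: integrable_sandwich.
Qed.

Lemma integral_sandwich_psd A M : hurwitz A -> psd M ->
  psd (integral0y_mx (sandwich A M)).
Proof.
move=> hA [Msym Mge0]; split; first exact: integral_sandwich_sym.
move=> x; rewrite form_integral_sandwich//; apply: Rintegral_ge0 => t _.
by rewrite sandwich_form; exact: Mge0.
Qed.

(** The form at x integrates a continuous nonnegative function whose value at t = 0 is x^T M x >
    0. *)
Lemma integral_sandwich_neq0 A M x : hurwitz A -> psd M ->
  0 < (x^T *m M *m x) 0 0 -> integral0y_mx (sandwich A M) <> 0.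
Proof.
move=> hA [Msym Mge0] Mx W0.
have := form_integral_sandwich A M x hA.
rewrite W0 mulmx0 mul0mx mxE => /esym/eqP.
rewrite gt_eqF//; apply: Rintegral_gt0.
- exact: integrable_form_sandwich.
- exact: continuous_form_sandwich.
- by move=> t; rewrite sandwich_form; exact: Mge0.
- by rewrite sandwich0.
Qed.
End Sandwich.

(** * Weighted sums of rank-one matrices and their quadratic forms *)

Section RankOneSums.
Context {R : realType}.

Lemma sum_rank1_form p m (I : finType) (Q : pred I) (c : I -> R)
    (B : 'M[R]_(p, m)) (u : I -> 'cV[R]_p) (x : 'cV[R]_m) :
  (x^T *m (\sum_(i | Q i) c i *: (B^T *m u i *m (u i)^T *m B)) *m x) 0 0 =
  \sum_(i | Q i) c i * ((u i)^T *m B *m x) 0 0 ^+ 2.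
Proof.
rewrite mulmx_sumr mulmx_suml summxE; apply: eq_bigr => i _.
rewrite -scalemxAr -scalemxAl mxE expr2; congr (_ * _).
set y := (u i)^T *m B *m x.
have -> : x^T *m (B^T *m u i *m (u i)^T *m B) *m x = y^T *m y.
  by rewrite /y !trmx_mul trmxK !mulmxA.
by rewrite mxE big_ord1 mxE.
Qed.

Lemma sum_rank1_sym p m (I : finType) (Q : pred I) (c : I -> R)
    (B : 'M[R]_(p, m)) (u : I -> 'cV[R]_p) :
  let M := \sum_(i | Q i) c i *: (B^T *m u i *m (u i)^T *m B) in M^T = M.
Proof.
rewrite /= raddf_sum; apply: eq_bigr => i _.
by rewrite /= linearZ /= !trmx_mul !trmxK !mulmxA.
Qed.
End RankOneSums.

(** * The spectral basis and the strict ordering of the covariances *)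

Lemma spectral_basis (R : realType) (n m : nat) (P : 'M[R]_n.+1) mu lambda u v
    (B : 'M[R]_(n.+1, m)) :
  spectral_system P mu lambda u v -> (forall i, (u i)^T *m B = 0) -> B = 0.
Proof.
move=> sp uB.
pose U := \matrix_(i, j) u i j 0; pose V := \matrix_(i, j) v j i 0.
(* Biorthogonality makes the matrix with rows u_i invertible, with inverse the matrix of columns
   v_j. *)
have UV : U *m V = 1%:M.
  apply/matrixP => i j; rewrite !mxE -(uv_biorth sp) !mxE.
  by apply: eq_bigr => k _; rewrite !mxE.
have UB : U *m B = 0.
  apply/matrixP => i j; have /matrixP/(_ 0 j) := uB i; rewrite !mxE => H.
  by rewrite -[RHS]H; apply: eq_bigr => k _; rewrite !mxE.
by rewrite -[B]mul1mx -(mulmx1C UV) -mulmxA UB mulmx0.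
Qed.

Lemma mean_field_H_mx (R : realType) (n D : nat) (mu : 'cV[R]_n.+1)
    (H : 'cV[R]_D -> 'I_n.+1 -> 'cV[R]_D) theta :
  mean_field mu H theta = (H_mx H theta)^T *m mu.
Proof.
apply/matrixP => j k; rewrite (ord1 k) summxE mxE; apply: eq_bigr => i _.
by rewrite !mxE mulrC.
Qed.

(** The two regimes share b but have their own exponents a1 < b < a3. [H_nonzero] excludes the
    degenerate case where H vanishes at theta in every state: both covariances would then be zero
    and the strict order would fail. *)
Theorem corollary3p5 (R : realType) (n D : nat)
    (P : 'M[R]_n.+1) (mu : 'cV[R]_n.+1)
    (lambda : 'I_n.+1 -> R) (u v : 'I_n.+1 -> 'cV[R]_n.+1)
    (H : 'cV[R]_D -> 'I_n.+1 -> 'cV[R]_D)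
    (alpha a1 a3 b : R) (theta : 'cV[R]_D)
    (P_ergodic : ergodic P)
    (mu_stationary : stationary P mu)
    (mu_int : int_simplex mu)
    (P_reversible : reversible P mu)
    (P_spectrum : spectral_system P mu lambda u v)
    (alpha_gt0 : 0 < alpha)
    (case_i : setting_i P mu H alpha a1 b)
    (case_iii : setting_iii P mu H alpha a3 b)
    (case_iii0 : setting_iii P mu H 0 a3 b)
    (theta_Theta : Theta mu H b theta)
    (H_nonzero : H_mx H theta != 0) :
  loewner_lt (V1 mu lambda u H theta b alpha) (V3 mu lambda u H theta alpha) /\
  V3 mu lambda u H theta alpha = V3 mu lambda u H theta 0.
Proof.
split; last exact: erefl.
have b_lt1 : b < 1.
  have [[[/andP[_ a3_le1] _] b_lt_a3] _ _ _] := case_iii.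
  exact: lt_le_trans a3_le1.
have half0 : half_ind b = 0 by rewrite /half_ind lt_eqF// mul0r.
have [h0 _ A_hurwitz] := theta_Theta.
rewrite half0 raddf0 addr0 in A_hurwitz.
set A := nabla (mean_field mu H) theta in A_hurwitz.
set B := H_mx H theta in H_nonzero.
set U1 := U_theta lambda u H theta alpha.
set U3 := U11 lambda u H theta.
have V1E : V1 mu lambda u H theta b alpha = integral0y_mx (sandwich A U1).
  by rewrite /V1 half0 raddf0 addr0.
rewrite V1E -[V3 _ _ _ _ _ _]/(integral0y_mx (sandwich A U3)).
have U1_sym : U1^T = U1 by exact: sum_rank1_sym.
have U3_sym : U3^T = U3 by exact: sum_rank1_sym.
(* The weight of the i-th rank-one matrix in U11 - U_theta; it is positive because alpha > 0 and -1
   < lambda_i < 1. *)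
pose c (i : 'I_n.+1) := (1 - 1 / (alpha * (1 + lambda i) + 1) ^+ 2) *
  ((1 + lambda i) / (1 - lambda i)).
have c_gt0 i : i != ord_max -> 0 < c i.
  move=> i_max.
  have l1 : 0 < 1 + lambda i by rewrite -ltrBlDl sub0r (lambda_gtN1 P_spectrum).
  have l2 : 0 < 1 - lambda i by rewrite subr_gt0 (lambda_lt1 P_spectrum).
  have s1 : 1 < alpha * (1 + lambda i) + 1 by rewrite ltrDr mulr_gt0.
  apply: mulr_gt0; last exact: divr_gt0.
  have s2 : 1 < (alpha * (1 + lambda i) + 1) ^+ 2 by rewrite exprn_egt1.
  rewrite subr_gt0 ltr_pdivrMr.
    by rewrite mul1r.
  exact: lt_trans s2.
have U31 : U3 - U1 =
    \sum_(i | i != ord_max) c i *: (B^T *m u i *m (u i)^T *m B).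
  rewrite /U3 /U1 /U11 /U_theta -sumrB; apply: eq_bigr => i _.
  by rewrite /c mulrBl scalerBl [1 * (_ / (1 - _))]mul1r.
clearbody c U1 U3.
have U31_psd : psd (U3 - U1).
  split; first by rewrite U31; exact: sum_rank1_sym.
  move=> x; rewrite U31 sum_rank1_form; apply: sumr_ge0 => i i_max.
  by apply: mulr_ge0; [exact/ltW/c_gt0|exact: sqr_ge0].
have [i /eqP uB] : exists i, (u i)^T *m B <> 0.
  apply: contrapT => /forallNP uB; move/eqP: H_nonzero; apply.
  by apply: (spectral_basis _ _ _ _ _ _ _ _ _ P_spectrum) => i; apply: contrapT.
(* The top left eigenvector is mu, for which mu^T H is the transpose of h(theta) = 0. *)
have i_max : i != ord_max.
  apply: contra uB => /eqP ->; rewrite (u_max P_spectrum).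
  by rewrite -[mu^T *m B]trmxK trmx_mul trmxK -mean_field_H_mx h0 trmx0.
have [j uBj] : exists j, ((u i)^T *m B) 0 j != 0.
  apply: contrapT => /forallNP uBj; move/eqP: uB; apply.
  apply/matrixP => k j; rewrite (ord1 k) [RHS]mxE.
  by apply/eqP; apply: contrapT => /negP; exact: uBj.
(* This test vector picks a nonzero entry of u_i^T H, so the i-th square in the form is positive. *)
pose x : 'cV[R]_D := delta_mx j 0.
have U31_pos : 0 < (x^T *m (U3 - U1) *m x) 0 0.
  rewrite U31 sum_rank1_form (bigD1 i i_max) /=; apply: ltr_wpDr.
    apply: sumr_ge0 => k /andP[k_max _].
    by apply: mulr_ge0; [exact/ltW/c_gt0|exact: sqr_ge0].
  apply: mulr_gt0; first exact: c_gt0.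
  have -> : ((u i)^T *m B *m x) 0 0 = ((u i)^T *m B) 0 j by rewrite -colE mxE.
  rewrite lt_def sqr_ge0 sqrf_eq0 uBj.
  exact: isT.
split.
- exact: integral_sandwich_sym.
- exact: integral_sandwich_sym.
- rewrite -(integral_sandwichB _ _ _ A_hurwitz).
  exact: integral_sandwich_psd.
(* Equal covariances would make the integral for [U3 - U1] vanish. *)
move=> V13; apply: (integral_sandwich_neq0 _ _ _ A_hurwitz U31_psd U31_pos).
by rewrite (integral_sandwichB _ _ _ A_hurwitz) V13 subrr.
Qed.
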